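(* Let $\Lambda$ be a finite dimensional algebra. Then the map $\kappa$ is well defined on $\mathrm{CJI}(\mathrm{tors}\,\Lambda)$ and gives a bijection $\kappa:\mathrm{CJI}(\mathrm{tors}\,\Lambda)\to\mathrm{CMI}(\mathrm{tors}\,\Lambda)$ such that, for every $\Lambda$-brick $M$, $$\kappa(\mathcal{T}_M)={}^{\perp}M .$$
   Context: Modules are finitely generated; $\mathrm{mod}\,\Lambda$ is the category of finitely generated $\Lambda$-modules. A torsion class is a full subcategory of $\mathrm{mod}\,\Lambda$ closed under isomorphisms, quotients and extensions. $\mathrm{tors}\,\Lambda$ is the complete lattice of torsion classes ordered by inclusion (meet is intersection). A module $M$ is a brick if $\mathrm{End}_\Lambda(M)$ is a division ring. $\mathrm{Gen}(M)$ is the class of quotients of finite direct sums of copies of $M$; $\mathrm{Filt}(\mathcal{C})$ is the class of modules having a finite filtration by submodules with successive quotients in $\mathcal{C}$ (up to isomorphism). Put $\mathcal{T}_M=\mathrm{Filt}(\mathrm{Gen}(M))$; it is known that $M\mapsto\mathcal{T}_M$ is a bijection from isomorphism classes of bricks to $\mathrm{CJI}(\mathrm{tors}\,\Lambda)$. ${}^{\perp}M=\{X\in\mathrm{mod}\,\Lambda:\mathrm{Hom}_\Lambda(X,M)=0\}$. An element $j$ of a lattice $L$ is completely join-irreducible if $j=\bigvee A$ implies $j\in A$ (the empty join is the bottom element, which is therefore not completely join-irreducible); such a $j$ in a complete lattice covers exactly one element, denoted $j_*$, and every element strictly below $j$ is $\le j_*$. Completely meet-irreducible is defined dually. $\mathrm{CJI}(L)$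 and $\mathrm{CMI}(L)$ are the sets of completely join-irreducible and completely meet-irreducible elements. For $j\in\mathrm{CJI}(L)$, $\kappa(j)$ is the unique maximum of $\{x\in L: j_*\le x \text{ and } j\not\le x\}$, when such an element exists. *)

(* Defs.v *)
(* MathComp world. *)
From HB Require Import structures.
From mathcomp Require Import all_boot all_order all_algebra all_field.

Set Implicit Arguments.
Unset Strict Implicit.
Unset Printing Implicit Defensive.

Import GRing.Theory.
Local Open Scope ring_scope.

(* Orders are Prop-valued relations and sets are Prop-valued predicates: the
   type of torsion classes is too large, as regards universes, for the order
   structures of MathComp together with the type [set] of classical_sets. *)
Section Lattices.
Variables (L : Type) (le : L -> L -> Prop).
Implicit Types (S : L -> Prop) (j m x y z : L).

Definition upper_bound S y : Prop := forall x, S x -> le x y.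
Definition lower_bound S y : Prop := forall x, S x -> le y x.

Definition maximum S x : Prop := S x /\ upper_bound S x.
Definition minimum S x : Prop := S x /\ lower_bound S x.

Definition is_join S x : Prop := minimum (upper_bound S) x.
Definition is_meet S x : Prop := maximum (lower_bound S) x.

(* The empty S excludes the bottom element from CJI and the top one from CMI. *)
Definition CJI j : Prop := forall S, is_join S j -> S j.
Definition CMI m : Prop := forall S, is_meet S m -> S m.

Definition lt x y : Prop := le x y /\ x <> y.
Definition covers y x : Prop := lt x y /\ forall z, lt x z -> ~ lt z y.

(* In a complete lattice, j in CJI covers exactly one element js, namely j_*. *)
Definition is_kappa j x : Prop :=
  exists2 js, covers j js & maximum (fun y => le js y /\ ~ le j y) x.

End Lattices.

Section Modules.
Variables (K : fieldType) (A : falgType K).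

Definition surjective (X Y : Type) (f : X -> Y) : Prop :=
  forall y, exists x, f x = y.

Definition finitely_generated (M : lmodType A) : Prop :=
  exists s : seq M, forall x : M,
    exists c : 'I_(size s) -> A, x = \sum_i c i *: s`_i.

Record fgmod := FgMod {
  fgmod_sort :> lmodType A;
  fgmodP : finitely_generated fgmod_sort }.

Definition brick (M : fgmod) : Prop :=
  (exists x : M, x <> 0) /\
  forall f : {linear M -> M}, (exists x, f x <> 0) ->
    exists g : {linear M -> M}, cancel f g /\ cancel g f.

Definition short_exact (X Y Z : lmodType A)
    (f : {linear X -> Y}) (g : {linear Y -> Z}) : Prop :=
  [/\ injective f, forall y, g y = 0 <-> (exists x, f x = y) & surjective g].

(* A torsion class is a nonempty subcategory, i.e. contains the zero modules. *)
Definition torsion_class (T : fgmod -> Prop) : Prop :=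
  [/\ forall X : fgmod, (forall x : X, x = 0) -> T X,
      forall (X Y : fgmod) (f : {linear X -> Y}), bijective f -> T X -> T Y,
      forall (X Y : fgmod) (f : {linear X -> Y}), surjective f -> T X -> T Y
    & forall (X Y Z : fgmod) (f : {linear X -> Y}) (g : {linear Y -> Z}),
        short_exact f g -> T X -> T Z -> T Y].

Record tors := Tors {
  tors_class :> fgmod -> Prop;
  torsP : torsion_class tors_class }.

Definition tors_le (T U : tors) : Prop := forall X, T X -> U X.

Lemma tors_meet (S : tors -> Prop) :
  exists2 T : tors, forall X, T X <-> (forall U, S U -> U X)
                  & is_meet tors_le S T.
Proof.
have tcS : torsion_class (fun X => forall U, S U -> U X).
  split=> [X X0 U _|X Y f fb TX U SU|X Y f fs TX U SU|X Y Z f g fg TX TZ U SU].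
  - by have [+ _ _ _] := torsP U; apply.
  - by have [_ iso _ _] := torsP U; apply: iso fb (TX U SU).
  - by have [_ _ quo _] := torsP U; apply: quo fs (TX U SU).
  - by have [_ _ _ ext] := torsP U; apply: ext fg (TX U SU) (TZ U SU).
exists (Tors tcS) => //; split=> [U SU X|T leT X TX U SU]; first exact.
exact: leT TX.
Qed.

Definition Gen (M : fgmod) (X : fgmod) : Prop :=
  exists n (f : {linear {ffun 'I_n -> M} -> X}), surjective f.

Definition perp (M : fgmod) (X : fgmod) : Prop :=
  forall (f : {linear X -> M}) (x : X), f x = 0.

End Modules.

Definition submod_sort (R : nzRingType) (X : lmodType R) (S : submodClosed X) :
  Type := {x : X | x \in S}.

HB.instance Definition _ (R : nzRingType) (X : lmodType R)
  (S : submodClosed X) := SubChoice.on (submod_sort S).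
HB.instance Definition _ (R : nzRingType) (X : lmodType R)
  (S : submodClosed X) := [SubChoice_isSubLmodule of submod_sort S by <:].

Section Filtrations.
Variables (K : fieldType) (A : falgType K).

(* S is contained in S', and S' / S is isomorphic to Q. *)
Definition subquotient (X : lmodType A) (S S' : submodClosed X)
    (Q : lmodType A) : Prop :=
  {subset S <= S'} /\
  exists2 p : {linear submod_sort S' -> Q},
    surjective p & forall x, p x = 0 <-> val x \in S.

Definition Filt (C : fgmod A -> Prop) (X : fgmod A) : Prop :=
  exists n (F : nat -> submodClosed X),
    [/\ forall x, x \in F 0 -> x = 0,
        forall x, x \in F n
      & forall i, (i < n)%N -> exists2 Q, C Q & subquotient (F i) (F i.+1) Q].

End Filtrations.

(* Main.v *)
Require Import Defs.
From HB Require Import structures.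
From mathcomp Require Import all_boot all_order all_algebra all_field.
From Stdlib Require Import ClassicalEpsilon FunctionalExtensionality.
From Stdlib Require Import PropExtensionality.

Set Implicit Arguments.
Unset Strict Implicit.
Unset Printing Implicit Defensive.

Import GRing.Theory.
Local Open Scope ring_scope.

(* Let M be a brick.  If N is a nonzero submodule of M then M / N lies in
   perp M: a nonzero map M / N -> M would give a nonzero noninjective
   endomorphism of M.  Hence a torsion class containing the quotients of M that
   lie in perp M, and not contained in perp M, contains M (it contains a
   nonzero submodule N of M, and M / N).  This shows that the maximum of the
   torsion classes strictly below T_M is T_M /\ perp M, that perp M is the
   maximum of the torsion classes above it not containing T_M, and that every
   torsion class strictly above perp M contains M.
   Conversely, modules of minimal dimension show that there are enough bricks:
   a minimal X in T \ U is a brick, so that T is the join of the T_M over the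
   bricks M in T; and if X is not in T then a minimal M with Hom(T, M) = 0 and
   Hom(X, M) <> 0 is a brick, so that T is the meet of the perp M that contain
   it.  Thus all elements of CJI are of the form T_M and those of CMI of the
   form perp M.  Finally, if perp M = perp N, then there are nonzero maps
   f : M -> N and g : N -> M, and f g <> 0 since M / im g is in perp N; so f g
   is invertible, N is a quotient of M and by symmetry T_M = T_N. *)

(** * Classical tools: extremal natural numbers and inverses by choice *)

Definition decb (P : Prop) : bool := excluded_middle_informative P.

Lemma decbP (P : Prop) : reflect P (decb P).
Proof.
by rewrite /decb; case: excluded_middle_informative => p; constructor.
Qed.

Lemma ex_max_nat (P : nat -> Prop) (m n0 : nat) :
    P n0 -> (forall n, P n -> (n <= m)%N) ->
  exists2 n, P n & forall k, P k -> (k <= n)%N.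
Proof.
move=> P0 ub.
have exP : exists n, decb (P n) by exists n0; apply/decbP.
have ubP n : decb (P n) -> (n <= m)%N by move/decbP/ub.
by case: (ex_maxnP exP ubP) => n /decbP Pn nP; exists n => // k /decbP/nP.
Qed.

Lemma ex_min_measure (T : Type) (mu : T -> nat) (P : T -> Prop) :
  (exists x, P x) -> exists2 x, P x & forall y, P y -> (mu x <= mu y)%N.
Proof.
move=> [x0 Px0]; pose Q n := decb (exists2 x, P x & mu x = n).
have exQ : exists n, Q n by exists (mu x0); apply/decbP; exists x0.
case: (ex_minnP exQ) => _ /decbP[x Px <-] xP; exists x => // y Py.
by apply: xP; apply/decbP; exists y.
Qed.

Lemma inj_surj_bijective (T U : Type) (f : T -> U) :
  injective f -> surjective f -> bijective f.
Proof.
move=> fi fs.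
have [g gK] := choice _ fs.
by exists g => // x; apply: fi; rewrite gK.
Qed.

(** * Submodules, quotients and factorisations *)

Section LinearMaps.
Variable R : nzRingType.
Implicit Types Q X Y Z : lmodType R.

(** The difference of two values at [x] is a value at 0, hence zero; so [r] is single-valued, and
    the function obtained by choice is linear. *)
Lemma linear_of_rel X Y (r : X -> Y -> Prop) :
    (forall x, exists y, r x y) ->
    (forall a x x' y y', r x y -> r x' y' -> r (a *: x + x') (a *: y + y')) ->
    (forall y, r 0 y -> y = 0) ->
  exists f : {linear X -> Y}, forall x, r x (f x).
Proof.
move=> r_tot r_lin r0.
have [f rf] := choice _ r_tot.
have r_fun x y y' : r x y -> r x y' -> y = y'.
  move=> rxy rxy'; apply/eqP; rewrite eq_sym -subr_eq0 addrC -scaleN1r.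
  by apply/eqP/r0; rewrite -(addNr x) -[- x]scaleN1r; apply: r_lin.
have lin_f : linear f by move=> a x x'; apply: r_fun (rf _) _; apply: r_lin.
pose lf := GRing.isLinear.Build R X Y *:%R f lin_f.
pose F : {linear X -> Y} := HB.pack f lf.
by exists F.
Qed.

Lemma factor_surj X Q Y (p : {linear X -> Q}) (f : {linear X -> Y}) :
    surjective p -> (forall x, p x = 0 -> f x = 0) ->
  exists g : {linear Q -> Y}, forall x, g (p x) = f x.
Proof.
move=> ps kpf; pose r q y := exists2 x, p x = q & f x = y.
have [|a q q' y y' [x <- <-] [x' <- <-]|y [x /kpf fx0 <-]//|g gP] :=
    @linear_of_rel Q Y r.
- by move=> q; have [x px] := ps q; exists (f x), x.
- by exists (a *: x + x'); rewrite linearP.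
exists g => x; have [x' pxx' <-] := gP (p x).
by apply/eqP; rewrite -subr_eq0 -linearB kpf // linearB pxx' subrr.
Qed.

Lemma factor_inj X Y Z (i : {linear X -> Y}) (f : {linear Z -> Y}) :
    injective i -> (forall z, exists x, i x = f z) ->
  exists g : {linear Z -> X}, forall z, i (g z) = f z.
Proof.
move=> ii fi; apply: (linear_of_rel fi) => [a z z' x x' ixz ixz'|x].
  by rewrite !linearP ixz ixz'.
by rewrite linear0 -(linear0 i) => /ii.
Qed.

Lemma ker0_inj X Y (f : {linear X -> Y}) :
  (forall x, f x = 0 -> x = 0) -> injective f.
Proof.
move=> kf x y fxy; apply/eqP; rewrite -subr_eq0; apply/eqP; apply: kf.
by rewrite linearB fxy subrr.
Qed.

Definition submod_pred X (P : X -> Prop) : Prop :=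
  P 0 /\ forall a x y, P x -> P y -> P (a *: x + y).

(** Bundled so that the submodule structure of [psub_mem P] can be inferred from [P]. *)
Record psub X := PSub { psub_prop : X -> Prop; _ : submod_pred psub_prop }.

Definition psub_mem X (P : psub X) : {pred X} := fun x => decb (psub_prop P x).

Lemma psub_memP X (P : psub X) x : reflect (psub_prop P x) (x \in psub_mem P).
Proof. exact: decbP. Qed.

Lemma psub_closed X (P : psub X) : GRing.subsemimod_closed (psub_mem P).
Proof.
case: P => P Pc; have [P0 Plin] := Pc.
split; first split=> [|x y /psub_memP Px /psub_memP Py].
- exact/psub_memP.
- by apply/psub_memP; rewrite -[x]scale1r; apply: Plin.
- move=> a x /psub_memP Px; apply/psub_memP.
  by rewrite -[_ *: _]addr0; apply: Plin.
Qed.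

HB.instance Definition _ X (P : psub X) :=
  GRing.isSubmodClosed.Build R X (psub_mem P) (psub_closed P).

Lemma submod_ex X (P : X -> Prop) : submod_pred P ->
  exists S : submodClosed X, forall x, x \in S <-> P x.
Proof.
move=> Pc; exists (psub_mem (PSub Pc) : submodClosed X) => x.
exact: iff_sym (rwP (psub_memP (PSub Pc) x)).
Qed.

End LinearMaps.

Section Quotients.
Variables (R : nzRingType) (X : lmodType R) (P : psub X).
Let S : zmodClosed X := psub_mem P.
Local Notation quot := (Quotient.quot S).
Local Open Scope quotient_scope.

Definition quot_pi (x : X) : quot := \pi_quot x.
(** [Quotient.quot] provides the additive group; scalars act on representatives, whose choice is
    immaterial by [quot_scale_pi]. *)
Definition quot_scale (a : R) (q : quot) : quot := quot_pi (a *: (repr q : X)).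

Lemma quot_pi_eq x y : (quot_pi x == quot_pi y) = (x - y \in S).
Proof. by rewrite Quotient.idealrBE. Qed.

Lemma quot_piD : {morph quot_pi : x y / x + y}.
Proof. exact: (@Quotient.pi_add _ S). Qed.

Lemma quot_reprK q : quot_pi (repr q) = q.
Proof. exact: reprK. Qed.

Lemma quot_scale_pi a x : quot_scale a (quot_pi x) = quot_pi (a *: x).
Proof.
apply/eqP; rewrite quot_pi_eq -scalerBr.
have h : repr (quot_pi x) - x \in S by rewrite -quot_pi_eq quot_reprK.
exact: (@GRing.rpredZ _ _ (psub_mem P : submodClosed X) a _ h).
Qed.

Fact quot_scalerA a b q : quot_scale a (quot_scale b q) = quot_scale (a * b) q.
Proof.
by rewrite -(quot_reprK q) (quot_scale_pi b) !quot_scale_pi scalerA.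
Qed.

Fact quot_scale1r : left_id 1 quot_scale.
Proof. by move=> q; rewrite -(quot_reprK q) quot_scale_pi scale1r. Qed.

Fact quot_scalerDr : right_distributive quot_scale +%R.
Proof.
move=> a p q; rewrite -(quot_reprK p) -(quot_reprK q).
by rewrite -quot_piD !quot_scale_pi -quot_piD scalerDr.
Qed.

Fact quot_scalerDl q : {morph quot_scale^~ q : a b / a + b}.
Proof.
by move=> a b; rewrite -(quot_reprK q) !quot_scale_pi -quot_piD scalerDl.
Qed.

HB.instance Definition _ := GRing.Zmodule_isLmodule.Build R quot
  quot_scalerA quot_scale1r quot_scalerDr quot_scalerDl.

Lemma quot_ex_psub : exists (Q : lmodType R) (p : {linear X -> Q}),
  surjective p /\ forall x, p x = 0 <-> psub_prop P x.
Proof.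
have lin_pi : linear quot_pi.
  by move=> a x y; rewrite quot_piD -quot_scale_pi.
pose lf := GRing.isLinear.Build R X quot *:%R quot_pi lin_pi.
pose p : {linear X -> quot} := HB.pack quot_pi lf.
exists quot, p; split=> [q|x]; first by exists (repr q); apply: quot_reprK.
apply: iff_trans (iff_sym (rwP (psub_memP P x))).
rewrite -[x in x \in _]subr0 -quot_pi_eq -(rwP eqP).
by rewrite -[quot_pi x]/(p x) -[quot_pi 0]/(p 0) linear0.
Qed.

End Quotients.

Lemma quot_ex (R : nzRingType) (X : lmodType R) (P : X -> Prop) :
  submod_pred P -> exists (Q : lmodType R) (p : {linear X -> Q}),
    surjective p /\ forall x, p x = 0 <-> P x.
Proof. by move=> Pc; apply: (quot_ex_psub (PSub Pc)). Qed.

(** * Dimension over the ground field *)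

Section Dimension.
Variables (K : fieldType) (A : falgType K).
Implicit Types X Y Z : lmodType A.

(* An A-module carries no K-module structure here: K acts through k%:A. *)
Definition kfree X n (v : 'I_n -> X) : Prop :=
  forall c : 'I_n -> K, \sum_i (c i)%:A *: v i = 0 -> forall i, c i = 0.

Definition kspan X n (v : 'I_n -> X) (x : X) : Prop :=
  exists c : 'I_n -> K, x = \sum_i (c i)%:A *: v i.

Definition vcons X n (x : X) (v : 'I_n -> X) (i : 'I_n.+1) : X :=
  if unlift ord0 i is Some j then v j else x.

Lemma algZ X (a b : K) (x : X) : (a * b)%:A *: x = a%:A *: (b%:A *: x).
Proof. by rewrite scalerA -scalerAl mul1r scalerA. Qed.

(** The products of a [K]-basis of [A] with the generators span over [K]. *)
Lemma fg_kspan X : finitely_generated X ->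
  exists n (v : 'I_n -> X), forall x, kspan v x.
Proof.
move=> [s sP]; pose b := vbasis {:A}.
pose I : finType := ('I_(size s) * 'I_(\dim {:A}))%type.
pose g (p : I) := tnth b p.2 *: s`_p.1.
exists #|I|, (fun j => g (enum_val j)) => x; have [c ->] := sP x.
pose d (p : I) := coord b p.2 (c p.1).
exists (fun j => d (enum_val j)).
rewrite -(reindex (fun j : 'I_#|I| => enum_val j) (op := +%R) (P := predT)
  (F := fun p => (d p)%:A *: g p)) /=; last first.
  by apply: onW_bij; apply: enum_val_bij.
rewrite -(pair_bigA _ (fun i j => (d (i, j))%:A *: g (i, j))) /=.
apply: eq_bigr => i _; rewrite {1}(coord_vbasis (memvf (c i))) scaler_suml.
apply: eq_bigr => j _.
by rewrite /d /g /= scalerA -scalerAl mul1r (tnth_nth 0).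
Qed.

Lemma kspan_fg X n (v : 'I_n -> X) : (forall x, kspan v x) ->
  finitely_generated X.
Proof.
(* The default 0 is never reached, every index being below [n]. *)
move=> vP; pose s := mkseq (fun i => oapp v 0 (insub i)) n.
exists s => x; have [c ->] := vP x.
exists (fun i => oapp (fun j => (c j)%:A) 0 (insub (val i))).
rewrite -(big_mkord predT (fun i =>
  oapp (fun j => (c j)%:A) 0 (insub i) *: s`_i)) size_mkseq big_mkord.
by apply: eq_bigr => i _; rewrite nth_mkseq // valK.
Qed.

(** Row [i] of [D] expresses [v i] through [g]; a row vector killed by [D] is a linear relation
    between the [v i], so [D] has full row rank. *)
Lemma kfree_bound X m (g : 'I_m -> X) : (forall x, kspan g x) ->
  forall n (v : 'I_n -> X), kfree v -> (n <= m)%N.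
Proof.
move=> gP n v vfree.
have [d dP] := choice _ (fun i => gP (v i)).
pose D := \matrix_(i, j) d i j.
suff /eqP <- : row_free D by apply: rank_leq_col.
rewrite -kermx_eq0; apply/rowV0P => u /sub_kermxP uD0; apply/rowP => i.
rewrite mxE; apply: vfree i.
under eq_bigr => i _ do rewrite dP scaler_sumr.
rewrite exchange_big big1 // => j _.
under eq_bigr => i _ do rewrite -algZ.
rewrite -scaler_suml -scaler_suml.
have -> : \sum_i u 0 i * d i j = (u *m D) 0 j.
  by rewrite mxE; apply: eq_bigr => i _; rewrite mxE.
by rewrite uD0 mxE !scale0r.
Qed.

Lemma sum_vcons X n (x : X) (v : 'I_n -> X) (c : 'I_n.+1 -> K) :
  \sum_i (c i)%:A *: vcons x v i =
  (c ord0)%:A *: x + \sum_i (c (lift ord0 i))%:A *: v i.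
Proof.
rewrite big_ord_recl /vcons unlift_none; congr (_ + _).
by apply: eq_bigr => i _; rewrite liftK.
Qed.

Lemma kfree_cons X n (x : X) (v : 'I_n -> X) : kfree v ->
  (forall (k : K) (c : 'I_n -> K),
     k%:A *: x + \sum_i (c i)%:A *: v i = 0 -> k = 0) ->
  kfree (vcons x v).
Proof.
move=> vfree xv c; rewrite sum_vcons => cv0.
have c0 := xv _ _ cv0; move: cv0; rewrite c0 !scale0r add0r => cv0 i.
by have [j ->|->//] := unliftP ord0 i; apply: vfree cv0 j.
Qed.

Lemma kspan_rel X n (x : X) (v : 'I_n -> X) (k : K) (c : 'I_n -> K) :
  k != 0 -> k%:A *: x + \sum_i (c i)%:A *: v i = 0 -> kspan v x.
Proof.
move=> k0 /(congr1 (fun y => (- k^-1)%:A *: y)).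
rewrite scalerDr -algZ mulNr mulVf // scaleNr scale1r scaleN1r scaler0.
move/eqP; rewrite addrC subr_eq0 => /eqP <-; rewrite scaler_sumr.
exists (fun i => - k^-1 * c i).
by apply: eq_bigr => i _; rewrite algZ.
Qed.

(** Finite dimension replaces noetherianity: a free family in [S] of maximal length spans [S], since
    an element outside its span could be added to it. *)
Lemma sub_fg X (S : submodClosed X) :
  finitely_generated X -> finitely_generated (submod_sort S).
Proof.
move=> /fg_kspan[m [g /kfree_bound ub]].
pose P n := exists v : 'I_n -> submod_sort S, kfree (fun i => val (v i)).
have P0 : P 0 by exists (fun _ => 0) => c _ [].
have [|n [v vfree] nmax] := ex_max_nat (m := m) P0; first by move=> n [v /ub].
apply: (@kspan_fg _ n v) => x; apply: NNPP => xNv.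
suff /nmax : P n.+1 by rewrite ltnn.
exists (vcons x v).
have -> : (fun i => val (vcons x v i)) = vcons (val x) (fun i => val (v i)).
  apply: functional_extensionality => i.
  by rewrite /vcons; case: unlift.
apply: kfree_cons => // k c kc0; apply/eqP; apply: contra_notT xNv => k0.
have : k%:A *: x + \sum_i (c i)%:A *: v i = 0.
  pose vl : {linear submod_sort S -> X} := val.
  have vl_inj : injective vl by apply: val_inj.
  apply: vl_inj; rewrite linear0 -[RHS]kc0 linearD linearZ linear_sum.
  by congr (_ + _); apply: eq_bigr => i _; rewrite linearZ.
exact: kspan_rel.
Qed.

Lemma surj_fg X Y (f : {linear X -> Y}) : surjective f ->
  finitely_generated X -> finitely_generated Y.
Proof.
move=> fs /fg_kspan[n [v vP]]; apply: (@kspan_fg _ n (fun i => f (v i))) => y.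
have [x <-] := fs y; have [c ->] := vP x; exists c.
by rewrite linear_sum; apply: eq_bigr => i _; rewrite linearZ.
Qed.

Implicit Types M N : fgmod A.

Definition has_kdim X n : Prop :=
  (exists v : 'I_n -> X, kfree v) /\
  forall k (v : 'I_k -> X), kfree v -> (k <= n)%N.

Lemma has_kdim_ex M : exists n, has_kdim M n.
Proof.
have [m [g /kfree_bound ub]] := fg_kspan (fgmodP M).
pose P n := exists v : 'I_n -> M, kfree v.
have P0 : P 0 by exists (fun _ => 0) => c _ [].
have [|n Pn nmax] := ex_max_nat (m := m) P0; first by move=> n [v /ub].
by exists n; split=> // k v vf; apply: nmax; exists v.
Qed.

Definition kdim M : nat :=
  proj1_sig (constructive_indefinite_description _ (has_kdim_ex M)).

Lemma kdimP M : has_kdim M (kdim M).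
Proof. exact: proj2_sig. Qed.

(** A longest free family of [M] has a free image, to which [y] can be added. *)
Lemma kdim_inj_lt M N (f : {linear M -> N}) y :
  injective f -> (forall x, f x <> y) -> (kdim M < kdim N)%N.
Proof.
move=> fi yNf; have [[v vfree] _] := kdimP M; have [_ ub] := kdimP N.
apply: (ub _ (vcons y (fun i => f (v i)))).
have fsum c : f (\sum_i (c i)%:A *: v i) = \sum_i (c i)%:A *: f (v i).
  by rewrite linear_sum; apply: eq_bigr => i _; rewrite linearZ.
apply: kfree_cons => [c|k c kc0].
  by rewrite -fsum -(linear0 f) => /fi/vfree.
apply/eqP/negPn/negP => k0; have [d] := kspan_rel k0 kc0.
by rewrite -fsum => /esym/yNf.
Qed.

(** A longest free family of [N] lifts to a free family of [M], to which the kernel element [x] can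
    be added. *)
Lemma kdim_surj_lt M N (f : {linear M -> N}) x :
  surjective f -> f x = 0 -> x <> 0 -> (kdim N < kdim M)%N.
Proof.
move=> fs fx0 x0; have [[w wfree] _] := kdimP N; have [_ ub] := kdimP M.
have [v fv] := choice _ (fun i => fs (w i)).
apply: (ub _ (vcons x v)).
have fsum c : f (\sum_i (c i)%:A *: v i) = \sum_i (c i)%:A *: w i.
  by rewrite linear_sum; apply: eq_bigr => i _; rewrite linearZ fv.
have vfree : kfree v.
  by move=> c cv0; apply: wfree; rewrite -fsum cv0 linear0.
apply: kfree_cons => // k c kc0; apply/eqP; apply: contra_notT x0 => k0.
have c0 i : c i = 0.
  apply: wfree i; move: (congr1 f kc0).
  by rewrite linearD linearZ fx0 /= scaler0 add0r linear0 fsum.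
rewrite big1 ?addr0 in kc0; last by move=> i _; rewrite c0 !scale0r.
by rewrite -[x]scale1r -(scale1r 1) -(mulVf k0) algZ kc0 scaler0.
Qed.

End Dimension.

(** * Torsion classes and filtrations *)

Section Torsion.
Variables (K : fieldType) (A : falgType K).
Implicit Types M N Q X Y Z : fgmod A.
Implicit Types T U : tors A.

(** * Submodules, images and cokernels of finitely generated modules *)

Definition subfg X (S : submodClosed X) : fgmod A :=
  FgMod (sub_fg S (fgmodP X)).

Definition incl X (S : submodClosed X) : {linear subfg S -> X} := val.

Lemma incl_inj X (S : submodClosed X) : injective (incl S).
Proof. exact: val_inj. Qed.

Lemma mem_incl X (S : submodClosed X) x : x \in S <-> exists s, incl S s = x.
Proof.
split=> [xS|[s <-]]; last exact: valP.
by exists (Sub x xS : submod_sort S); apply: SubK.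
Qed.

Lemma sub_ex X (P : X -> Prop) : submod_pred P ->
  exists (S : fgmod A) (i : {linear S -> X}),
    injective i /\ forall x, P x <-> exists s, i s = x.
Proof.
move=> /submod_ex[S SP]; exists (subfg S), (incl S).
by split=> [|x]; [apply: incl_inj | rewrite -SP mem_incl].
Qed.

Lemma quofg_ex X (P : X -> Prop) : submod_pred P ->
  exists (Q : fgmod A) (p : {linear X -> Q}),
    surjective p /\ forall x, p x = 0 <-> P x.
Proof.
move=> /quot_ex[Q [p [ps pP]]].
by exists (FgMod (surj_fg ps (fgmodP X))), p.
Qed.

Lemma img_submod X Y (f : {linear X -> Y}) :
  submod_pred (fun y => exists x, f x = y).
Proof.
split=> [|a y y' [x <-] [x' <-]]; first by exists 0; apply: linear0.
by exists (a *: x + x'); apply: linearP.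
Qed.

Lemma ker_submod X Y (f : {linear X -> Y}) : submod_pred (fun x => f x = 0).
Proof.
split=> [|a x x' fx fx']; first exact: linear0.
by rewrite linearP fx fx' scaler0 addr0.
Qed.

Lemma coker_ex X Y (f : {linear X -> Y}) :
  exists (Q : fgmod A) (p : {linear Y -> Q}),
    surjective p /\ forall y, p y = 0 <-> exists x, f x = y.
Proof. exact: quofg_ex (img_submod f). Qed.

Lemma image_ex X Y (f : {linear X -> Y}) :
  exists (I : fgmod A) (p : {linear X -> I}) (i : {linear I -> Y}),
    [/\ surjective p, injective i & forall x, i (p x) = f x].
Proof.
have [I [i [ii iP]]] := sub_ex (img_submod f).
have [z|p pP] := factor_inj ii (f := f); first by apply/iP; exists z.
exists I, p, i; split=> // z; have [x fx] := (iP (i z)).2 (ex_intro _ z erefl).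
by exists x; apply: ii; rewrite pP.
Qed.

(** * Closure properties of torsion classes, [perp] and intersections *)

Lemma tors0 T X : (forall x : X, x = 0) -> T X.
Proof. by have [+ _ _ _] := torsP T; apply. Qed.

Lemma tors_iso T X Y (f : {linear X -> Y}) : bijective f -> T X -> T Y.
Proof. by have [_ + _ _] := torsP T; apply. Qed.

Lemma tors_quo T X Y (f : {linear X -> Y}) : surjective f -> T X -> T Y.
Proof. by have [_ _ + _] := torsP T; apply. Qed.

Lemma tors_ext T X Y Z (f : {linear X -> Y}) (g : {linear Y -> Z}) :
  short_exact f g -> T X -> T Z -> T Y.
Proof. by have [_ _ _ +] := torsP T; apply. Qed.

(** Extensionality identifies the predicates, and proof irrelevance the remaining field. *)
Lemma tors_le_anti T U : tors_le T U -> tors_le U T -> T = U.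
Proof.
case: T U => T tT [U tU] /= TU UT.
have TE : T = U.
  apply: functional_extensionality => X; apply: propositional_extensionality.
  by split; [apply: TU | apply: UT].
by subst U; congr Tors; apply: proof_irrelevance.
Qed.

Lemma short_exact0 X Y Z (f : {linear X -> Y}) (g : {linear Y -> Z}) x :
  short_exact f g -> g (f x) = 0.
Proof. by case=> _ gf _; apply/gf; exists x. Qed.

(** For extensions: a map from [Y] to [M] vanishes on [X], so it factors through [Z], where it
    vanishes too. *)
Lemma perp_torsion M : torsion_class (perp M).
Proof.
have quo X Y (f : {linear X -> Y}) : surjective f -> perp M X -> perp M Y.
  by move=> fs XM g y; have [x <-] := fs y; apply: (XM (g \o f) x).
split=> //.
- by move=> X X0 f x; rewrite (X0 x) linear0.
- by move=> X Y f [g _ gK]; apply: quo => y; exists (g y).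
- move=> X Y Z f g fgE XM ZM h y; have [_ gf gs] := fgE.
  have [|h' <-] := factor_surj gs (f := h); last exact: ZM.
  by move=> z /gf[x <-]; apply: (XM (h \o f)).
Qed.

Definition perp_tors M : tors A := Tors (perp_torsion M).

Lemma tors_cap_torsion T U : torsion_class (fun X => T X /\ U X).
Proof.
split.
- by move=> X X0; split; apply: tors0.
- by move=> X Y f fb [TX UX]; split;
  [apply: tors_iso fb TX | apply: tors_iso fb UX].
- by move=> X Y f fs [TX UX]; split;
  [apply: tors_quo fs TX | apply: tors_quo fs UX].
- move=> X Y Z f g fg [TX UX] [TZ UZ].
  by split; [apply: tors_ext fg TX TZ | apply: tors_ext fg UX UZ].
Qed.

Definition tors_cap T U : tors A := Tors (tors_cap_torsion T U).

(* Filt as an inductive predicate, so that closure under quotients and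
   extensions is proved by structural induction. *)
Inductive filtered (C : fgmod A -> Prop) : fgmod A -> Prop :=
| filtered0 X : (forall x : X, x = 0) -> filtered C X
| filteredS X Y Q (f : {linear X -> Y}) (g : {linear Y -> Q}) :
    short_exact f g -> filtered C X -> C Q -> filtered C Y.

Section Filtered.
Variable C : fgmod A -> Prop.
Hypothesis C_quo :
  forall X Y (f : {linear X -> Y}), surjective f -> C X -> C Y.

(** In the inductive step, the target [Z] of [h] has as submodule the image [I] of the smaller
    filtered module, and [Z / I] is a quotient of the top factor [Q]. *)
Lemma filtered_quo X Y (h : {linear X -> Y}) :
  surjective h -> filtered C X -> filtered C Y.
Proof.
move=> hs FX; elim: FX Y h hs => {X} [X X0|X Y Q f g fg FX IH CQ] Z h hs.
  by apply: filtered0 => y; have [x <-] := hs y; rewrite (X0 x) linear0.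
have [I [p [i [ps ii pi]]]] := image_ex (h \o f).
have [R [q [qs qP]]] := coker_ex i.
apply: (filteredS (f := i) (g := q) _ (IH I p ps)); first by split.
have [_ gf gs] := fg.
have [|r rP] := factor_surj gs (f := q \o h).
  by move=> y /gf[x <-]; apply/qP; exists (p x); rewrite pi.
apply: (C_quo (f := r)) CQ => z; have [y <-] := qs z; have [x <-] := hs y.
by exists (g x); rewrite rP.
Qed.

(** Induction on the filtration of [Z]: the preimage [Y'] in [Y] of its submodule [Z'] is an
    extension of [Z'] by [X], and [Y / Y'] is the top factor [Q]. *)
Lemma filtered_ext X Y Z (f : {linear X -> Y}) (g : {linear Y -> Z}) :
  short_exact f g -> filtered C X -> filtered C Z -> filtered C Y.
Proof.
move=> fg FX FZ; elim: FZ Y f g fg => {Z} [Z Z0|Z' Z Q i q iq _ IH CQ] Y f g fg.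
  (* When [Z] is zero, [f] is onto. *)
  apply: (filtered_quo (h := f)) FX => y; have [_ gf _] := fg.
  by apply/gf; rewrite (Z0 (g y)).
have [Y' [k [ki kP]]] := sub_ex (ker_submod (q \o g)).
have [fi gf gs] := fg; have [ii qi qs] := iq.
have qgk y : q (g (k y)) = 0 by apply/kP; exists y.
have [z|f' f'P] := factor_inj ki (f := f).
  apply/kP => /=; rewrite (short_exact0 _ fg); exact: linear0.
have [y|g' g'P] := factor_inj ii (f := g \o k); first exact/qi/qgk.
have f'g' : short_exact f' g'.
  split=> [x x' /(congr1 k)|y|z].
  - by rewrite !f'P => /fi.
  - split=> [g'y|[x <-]]; last first.
      by apply: ii; rewrite g'P /= f'P (short_exact0 _ fg) linear0.
    have /gf[x fx] : g (k y) = 0 by rewrite -[g (k y)]g'P g'y linear0.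
    by exists x; apply: ki; rewrite f'P.
  - have [y gy] := gs (i z).
    have /kP[y' ky'] : (q \o g) y = 0 by rewrite /= gy (short_exact0 _ iq).
    by exists y'; apply: ii; rewrite g'P /= ky'.
apply: (filteredS (f := k) (g := q \o g) _ (IH _ _ _ f'g')) CQ; split=> //.
by move=> z; have [z' <-] := qs z; have [y <-] := gs z'; exists y.
Qed.

Lemma filtered_torsion : torsion_class (filtered C).
Proof.
split; [exact: filtered0 | | exact: filtered_quo | exact: filtered_ext].
by move=> X Y f [g _ gK]; apply: filtered_quo => y; exists (g y).
Qed.

(** By induction on [i], each step [F i] of the filtration is itself filtered; the last one is all
    of [X]. *)
Lemma Filt_filtered X : Filt C X -> filtered C X.
Proof.
move=> [n [F [F0 Fn FS]]].
suff FF i : (i <= n)%N -> filtered C (subfg (F i)).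
  apply: (filtered_quo (h := incl (F n))) (FF n (leqnn n)) => x.
  exact/mem_incl.
elim: i => [_|i IH lt_in].
  apply: filtered0 => x; apply: incl_inj; rewrite linear0.
  by apply: F0; apply: valP.
have [Q CQ [sF [p ps pP]]] := FS i lt_in.
have [x|j jP] := factor_inj (@incl_inj _ (F i.+1)) (f := incl (F i)).
  by apply/mem_incl/sF; apply/mem_incl; exists x.
apply: (filteredS (f := j) (g := p) _ (IH (ltnW lt_in))) CQ; split=> //.
  by move=> x y /(congr1 (incl _)); rewrite !jP => /incl_inj.
move=> y; rewrite pP mem_incl; split=> [[x xy]|[x <-]]; exists x.
  by apply: incl_inj; rewrite jP.
exact: esym (jP x).
Qed.

(** The filtration of the submodule is carried into [Y] by [f], and [Y] is added on top. *)
Lemma filtered_Filt X : filtered C X -> Filt C X.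
Proof.
elim=> {X} [X X0|X Y Q f g [fi gf gs] _ [n [F [F0 Fn FS]]] CQ].
  have [|S SP] := @submod_ex A X (fun _ => True); first by split.
  by exists 0, (fun=> S); split=> // x; apply/SP.
(* The guard [i <= n] lets one formula give the image of [F i] up to [n], and the whole of [Y] from
   [n.+1] on. *)
have imgF i :
    submod_pred (fun y => (i <= n)%N -> exists2 x, x \in F i & f x = y).
  split=> [_|a y y' Fy Fy' i_n]; first by exists 0; rewrite ?rpred0 ?linear0.
  have [x Fx <-] := Fy i_n; have [x' Fx' <-] := Fy' i_n.
  by exists (a *: x + x'); rewrite ?linearP // rpredD ?rpredZ.
have [F' F'P] := choice _ (fun i => submod_ex (imgF i)).
have F'in i x : (i <= n)%N -> f x \in F' i <-> x \in F i.
  move=> i_n; rewrite F'P; split=> [/(_ i_n)[x' Fx' /fi <-] //|Fx _].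
  by exists x.
have F'out i y : (n < i)%N -> y \in F' i.
  by move=> n_i; apply/F'P; rewrite leqNgt n_i.
exists n.+1, F'; split=> [y /F'P[//|x /F0 -> <-]|y|i]; first exact: linear0.
  exact: F'out.
(* The top factor is [Y] modulo the image of [f], that is [Q]; the lower ones come from [X]. *)
rewrite ltnS leq_eqVlt => /predU1P[->|lt_in].
  exists Q => //; split=> [y _|]; first exact: F'out.
  exists (g \o incl (F' n.+1)) => [z|y] /=.
    have [y <-] := gs z.
    by have /mem_incl[y' <-] : y \in F' n.+1 by [apply: F'out]; exists y'.
  split=> [/gf[x fx]|]; first by rewrite -[val y]fx; apply/F'in.
  by move/F'P => /(_ (leqnn n))[x _ fx]; apply/gf; exists x.
have [R CR [sF [p ps pP]]] := FS i lt_in; exists R => //; split.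
  move=> y /F'P/(_ (ltnW lt_in))[x Fx <-]; apply/F'in => //; exact: sF.
(* Here [f] identifies [F i.+1] with [F' i.+1]; the map [h] obtained next is the inverse. *)
have ci : injective (f \o incl (F i.+1)) by apply: inj_comp fi (@incl_inj _ _).
have [y|h hP] := factor_inj ci (f := incl (F' i.+1)).
  have /F'P/(_ lt_in)[x /mem_incl[x' <-] <-] : incl _ y \in F' i.+1.
    by apply/mem_incl; exists y.
  by exists x'.
exists (p \o h) => [z|y] /=.
  have [x <-] := ps z.
  have /mem_incl[y xy] : f (incl _ x) \in F' i.+1.
    by apply/F'in => //; apply/mem_incl; exists x.
  by exists y; congr (p _); apply: ci; rewrite hP.
rewrite pP -(F'in _ _ (ltnW lt_in)).
by have -> : f (val (h y)) = val y by apply: hP.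
Qed.

End Filtered.

End Torsion.

(** * Bricks *)

Section Bricks.
Variables (K : fieldType) (A : falgType K).
Implicit Types M N Q X Y Z : fgmod A.
Implicit Types T U j m : tors A.

(** * The torsion class generated by a module *)

Lemma Gen_quo M X Y (f : {linear X -> Y}) : surjective f -> Gen M X -> Gen M Y.
Proof.
move=> fs [n [g gs]]; exists n, (f \o g) => y.
by have [x <-] := fs y; have [v <-] := gs x; exists v.
Qed.

Lemma Gen_self M : Gen M M.
Proof.
pose ev (v : {ffun 'I_1 -> M}) := v ord0.
have lin_ev : linear ev by move=> a u v; rewrite /ev !ffunE.
pose lf := GRing.isLinear.Build A {ffun 'I_1 -> M} M *:%R ev lin_ev.
pose e : {linear {ffun 'I_1 -> M} -> M} := HB.pack ev lf.
by exists 1, e => y; exists [ffun=> y]; rewrite /= /ev ffunE.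
Qed.

(** Induction on [n]: the image under [f] of the last [n] summands is a quotient of their sum, and
    [X] modulo this image is a quotient of the first summand. *)
Lemma Gen_tors T M X : T M -> Gen M X -> T X.
Proof.
move=> TM [n [f fs]]; elim: n X f fs => [|n IH] X f fs.
  apply: tors0 => x; have [v <-] := fs x.
  by rewrite -(linear0 f); congr (f _); apply/ffunP=> -[].
pose ext (v : {ffun 'I_n -> M}) : {ffun 'I_n.+1 -> M} :=
  [ffun i => if unlift ord0 i is Some k then v k else 0].
pose hd (y : M) : {ffun 'I_n.+1 -> M} :=
  [ffun i => if unlift ord0 i is Some k then 0 else y].
have lin_ext : linear ext.
  move=> a u v; apply/ffunP => i; rewrite !ffunE.
  by case: unlift => [k|]; rewrite ?ffunE ?scaler0 ?addr0.
have lin_hd : linear hd.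
  move=> a u v; apply/ffunP => i; rewrite !ffunE.
  by case: unlift => [k|]; rewrite ?scaler0 ?addr0.
pose e : {linear {ffun 'I_n -> M} -> {ffun 'I_n.+1 -> M}} :=
  HB.pack ext (GRing.isLinear.Build A _ _ *:%R ext lin_ext).
pose h : {linear M -> {ffun 'I_n.+1 -> M}} :=
  HB.pack hd (GRing.isLinear.Build A _ _ *:%R hd lin_hd).
have split_v (v : {ffun 'I_n.+1 -> M}) :
    v = hd (v ord0) + ext [ffun k => v (lift ord0 k)].
  apply/ffunP=> i; rewrite !ffunE.
  by case: unliftP => [k ->|->]; rewrite ?ffunE ?add0r ?addr0.
have P1 : submod_pred (fun x => exists v, f (e v) = x).
  split=> [|a x y [u <-] [v <-]]; first by exists 0; rewrite !linear0.
  by exists (a *: u + v); rewrite !linearP.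
have [S [i [ii iP]]] := sub_ex P1; have [Q [p [ps pP]]] := quofg_ex P1.
have pfe v : p (f (e v)) = 0 by apply/pP; exists v.
have [v|g gP] := factor_inj ii (f := f \o e); first by apply/iP; exists v.
apply: (tors_ext (f := i) (g := p)).
- by split=> // x; rewrite pP iP.
- apply: (IH _ g) => s; have [v fv] := (iP (i s)).2 (ex_intro _ s erefl).
  by exists v; apply: ii; rewrite gP.
- apply: (tors_quo (f := p \o f \o h)) TM => q.
  have [x <-] := ps q; have [v <-] := fs x; exists (v ord0).
  by rewrite [in RHS](split_v v) linearD linearD [X in _ = _ + X]pfe addr0.
Qed.

(** This is $\mathcal{T}_M$, stated with [filtered], for which the closure properties are proved;
    [tgenE] returns to [Filt]. *)
Definition tgen M : tors A :=
  Tors (filtered_torsion (@Gen_quo M)).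

Lemma tgenE M X : tgen M X <-> Filt (Gen M) X.
Proof.
split; first exact: filtered_Filt.
exact: (Filt_filtered (@Gen_quo M)).
Qed.

Lemma tgen_self M : tgen M M.
Proof.
have [|S [i [ii iP]]] := @sub_ex _ _ M (fun x => x = 0).
  by split=> // a x y -> ->; rewrite scaler0 addr0.
apply: (@filteredS _ _ (Gen M) S M M i idfun).
- by split=> [//|y|y]; [rewrite -iP | exists y].
- apply: filtered0 => s; apply: ii; rewrite linear0.
  by apply/iP; exists s.
- exact: Gen_self.
Qed.

(** With [tgen_self], this characterises [tgen M] as the least torsion class containing [M]. *)
Lemma tgen_min M T : T M -> tors_le (tgen M) T.
Proof.
move=> TM X; elim=> {X} [X X0|X Y Q f g fg _ TX GQ]; first exact: tors0.
by apply: tors_ext fg TX (Gen_tors TM GQ).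
Qed.

(** * Endomorphisms and submodules of bricks *)

Lemma perpNE M X : ~ perp M X -> exists (f : {linear X -> M}) x, f x <> 0.
Proof.
move=> /not_all_ex_not[f /not_all_ex_not[x fx]]; by exists f, x.
Qed.

Lemma perp_self M x : perp M M -> x = 0 :> M.
Proof. by move=> /(_ idfun x). Qed.

Lemma perp_sub M N X (i : {linear N -> M}) :
  injective i -> perp M X -> perp N X.
Proof.
by move=> ii XM f x; apply: ii; rewrite linear0; apply: (XM (i \o f)).
Qed.

Lemma brick_bij M (f : {linear M -> M}) x :
  brick M -> f x <> 0 -> bijective f.
Proof.
by move=> [_ Mb] fx; have [|g [fg gf]] := Mb f; [exists x | exists g].
Qed.

(** By dimension, an endomorphism that is injective or surjective is bijective. *)
Lemma brickI M : (exists x : M, x <> 0) ->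
    (forall f : {linear M -> M}, (exists x, f x <> 0) ->
       injective f \/ surjective f) ->
  brick M.
Proof.
move=> M0 Mf; split=> // f /Mf f_is.
have fs : surjective f.
  case: f_is => // fi y; apply: NNPP => yNf.
  have /(kdim_inj_lt fi) : forall x, f x <> y.
    by move=> x fx; apply: yNf; exists x.
  by rewrite ltnn.
have fi : injective f.
  apply: ker0_inj => x fx; apply: NNPP => x0.
  by have := kdim_surj_lt fs fx x0; rewrite ltnn.
have [z|g gK] := factor_inj fi (f := idfun); first exact: fs.
by exists g; split=> // x; apply: fi; rewrite gK.
Qed.

(** A nonzero map [f] from [Q] to [M] would make [f \o p] a bijection killing the nonzero element
    [i y]. *)
Lemma brick_coker M N Q (i : {linear N -> M}) (p : {linear M -> Q}) y :
    brick M -> surjective p -> p (i y) = 0 -> i y <> 0 ->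
  perp M Q.
Proof.
move=> Mb ps piy iy f q; apply: NNPP; have [x <-] := ps q => fpx.
have [g gK _] := brick_bij (f := f \o p) Mb fpx; apply: iy.
by rewrite -[LHS]gK /= piy -(linear0 p) -[f _]/((f \o p) 0) gK.
Qed.

Lemma brick_submodule M N T (i : {linear N -> M}) y :
    brick M -> injective i -> i y <> 0 -> T N ->
    (forall Q (p : {linear M -> Q}), surjective p -> perp M Q -> T Q) ->
  T M.
Proof.
move=> Mb ii iy TN TQ; have [Q [p [ps pP]]] := coker_ex i.
apply: (tors_ext (f := i) (g := p)) TN (TQ _ p ps _) => //.
apply: brick_coker ps _ iy => //.
by apply/pP; exists y.
Qed.

(** The image of a nonzero map from [X] to [M] is a nonzero submodule of [M] lying in [T], so
    [brick_submodule] applies. *)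
Lemma brick_tors M T X : brick M -> T X -> ~ perp M X ->
    (forall Q (p : {linear M -> Q}), surjective p -> perp M Q -> T Q) ->
  T M.
Proof.
move=> Mb TX /perpNE[f [x fx]] TQ; have [I [p [i [ps ii pi]]]] := image_ex f.
apply: (brick_submodule (i := i) (y := p x)) TQ; rewrite ?pi //.
exact: tors_quo ps TX.
Qed.

(** * Irreducibility of [tgen M] and [perp_tors M], and the value of kappa *)

(** Otherwise [T] contains a nonzero submodule [I] of [M]. A nonzero map from [M] to [I] then gives
    a bijective endomorphism of [M], so [I] is all of [M], which would lie in [T]. *)
Lemma tgen_lt M T : brick M -> tors_le T (tgen M) -> ~ T M ->
  tors_le T (perp_tors M).
Proof.
move=> Mb TM TNM X TX; apply: NNPP => /perpNE[f [x fx]].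
have [I [p [i [ps ii pi]]]] := image_ex f.
have TI : T I by apply: tors_quo ps TX.
(* If all maps from [M] to [I] were zero, [perp I] would contain [tgen M], hence [I] itself, and [I]
   would be zero. *)
have /perpNE[g [y gy]] : ~ perp I M.
  move=> /(@tgen_min M (perp_tors I))/(_ _ (TM _ TI))/perp_self.
  by move=> /(_ (p x)) px0; apply: fx; rewrite -pi px0 linear0.
have igy : i (g y) <> 0 by rewrite -(linear0 i) => /ii.
have [h hK Kh] := brick_bij (f := i \o g) Mb igy.
apply: TNM; apply: (tors_iso (f := i)) TI.
apply: inj_surj_bijective => // z; exists (g (h z)); exact: Kh.
Qed.

(** The element $j_*$ for $j = \mathcal{T}_M$ with [M] a brick, by [tgen_covers]. *)
Definition tgen_lower M := tors_cap (tgen M) (perp_tors M).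

Lemma tgen_lower_max M T : brick M -> tors_le T (tgen M) -> T <> tgen M ->
  tors_le T (tgen_lower M).
Proof.
move=> Mb TM TNM X TX; split; first exact: TM.
apply: (tgen_lt Mb TM) TX => T_M; apply: TNM.
by apply: tors_le_anti => //; apply: tgen_min.
Qed.

Lemma brick_perpN M : brick M -> ~ perp M M.
Proof. by move=> [[x x0] _] /perp_self. Qed.

Lemma tgen_lower_lt M : brick M -> lt (@tors_le K A) (tgen_lower M) (tgen M).
Proof.
move=> Mb; split=> [X []//|E]; apply: (brick_perpN Mb).
by have := tgen_self M; rewrite -E => -[].
Qed.

(** If [tgen M] is not in [S], all members of [S] lie below [tgen_lower M], and so does their
    join. *)
Lemma tgen_CJI M : brick M -> CJI (@tors_le K A) (tgen M).
Proof.
move=> Mb S [ubS leS]; apply: NNPP => SNM.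
have /leS : upper_bound (@tors_le K A) S (tgen_lower M).
  move=> T ST; apply: tgen_lower_max (ubS T ST) _ => // E.
  by apply: SNM; rewrite -E.
by have [_ N] := tgen_lower_lt Mb => /(_ M (tgen_self M))[_ /(brick_perpN Mb)].
Qed.

Lemma tgen_covers M T : brick M ->
  covers (@tors_le K A) (tgen M) T <-> T = tgen_lower M.
Proof.
move=> Mb; split=> [[[TM TNM] TC]|->].
  have TL := tgen_lower_max Mb TM TNM.
  by apply: NNPP => TNL; apply: (TC (tgen_lower M)) => //; apply: tgen_lower_lt.
split; first exact: tgen_lower_lt.
move=> U [LU LNU] [UM UNM]; apply: LNU.
by apply: tors_le_anti => //; apply: tgen_lower_max.
Qed.

(** Quotients of [M] lying in [perp M] belong to [tgen_lower M], hence to [T]; so [brick_tors] puts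
    [M] in [T] unless [T] is below [perp_tors M]. *)
Lemma kappa_maximum M : brick M ->
  maximum (@tors_le K A)
    (fun T => tors_le (tgen_lower M) T /\ ~ tors_le (tgen M) T) (perp_tors M).
Proof.
move=> Mb; split=> [|T [LT MNT] X TX].
  split=> [X []//|MM]; apply: (brick_perpN Mb).
  exact: (MM _ (tgen_self M)).
apply: NNPP => XNM; apply: MNT; apply: tgen_min.
apply: (brick_tors Mb TX XNM) => Q p ps QM; apply: LT; split=> //.
exact: tors_quo ps (tgen_self M).
Qed.

Lemma kappaP M T : brick M ->
  is_kappa (@tors_le K A) (tgen M) T <-> T = perp_tors M.
Proof.
move=> Mb; have [kM ub] := kappa_maximum Mb.
split=> [[js /(tgen_covers _ Mb) -> [kT ubT]]|->].
  by apply: tors_le_anti; [apply: ub | apply: ubT].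
by exists (tgen_lower M); [apply/tgen_covers | split].
Qed.

(** If [perp_tors M] is not in [S], every member of [S] is strictly above it and contains [M]; then
    so does the meet [perp_tors M], which is absurd. *)
Lemma perp_CMI M : brick M -> CMI (@tors_le K A) (perp_tors M).
Proof.
move=> Mb S mS; apply: NNPP => SNM; have [lbS geS] := mS.
suff lbM : lower_bound (@tors_le K A) S (tgen M).
  by apply: (brick_perpN Mb); apply: (geS _ lbM); apply: tgen_self.
move=> U SU.
apply: tgen_min; have MU := lbS U SU.
have [X [UX XNM]] : exists X, U X /\ ~ perp M X.
  apply: NNPP => UM; apply: SNM; rewrite (_ : perp_tors M = U) //.
  apply: tors_le_anti => // X UX; apply: NNPP => XNM.
  by apply: UM; exists X.
by apply: (brick_tors Mb UX XNM) => Q p _; apply: MU.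
Qed.

(** * Enough bricks: every irreducible element comes from one *)

(** In a counterexample [M] of least dimension, a nonzero endomorphism that is not onto has image
    and cokernel in [T] and smaller than [M], hence in [U]; then [M] is in [U] as their
    extension. *)
Lemma tors_le_bricks T U :
  (forall M, brick M -> T M -> U M) -> tors_le T U.
Proof.
move=> TU X TX; apply: NNPP => UNX.
pose P Y := T Y /\ ~ U Y.
have [|M [TM UNM] minM] := @ex_min_measure _ (@kdim K A) P.
  by exists X.
have ltU Y : T Y -> (kdim Y < kdim M)%N -> U Y.
  by move=> TY YM; apply: NNPP => UNY; move: YM; rewrite ltnNge minM.
apply: (UNM); apply: TU => //; apply: brickI => [|f [x fx]].
  apply: NNPP => M0; apply: UNM; apply: tors0 => x; apply: NNPP => x0.
  by apply: M0; exists x.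
right; apply: NNPP => /not_all_ex_not[y yNf].
have [I [p [i [ps ii pi]]]] := image_ex f.
have [Q [q [qs qP]]] := coker_ex i.
apply: UNM; apply: (tors_ext (f := i) (g := q)); first by split.
  apply: ltU; first exact: tors_quo ps TM.
  apply: (kdim_inj_lt (y := y) ii) => z; have [t <-] := ps z.
  by rewrite pi => ft; apply: yNf; exists t.
apply: ltU; first exact: tors_quo qs TM.
by apply: kdim_surj_lt qs _ fx; apply/qP; exists (p x).
Qed.

Lemma tors_perp_bricks T X : ~ T X ->
  exists M, [/\ brick M, tors_le T (perp_tors M) & ~ perp M X].
Proof.
move=> TNX.
(* A smallest quotient [Y] of [X] outside [T] works: if a module of [T] had a nonzero image [I] in
   [Y], then [Y / I] would be in [T] by minimality, and so would [Y]. *)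
have [Y0 [TY0 Y0X]] : exists Y, tors_le T (perp_tors Y) /\ ~ perp Y X.
  pose P Y := (exists p : {linear X -> Y}, surjective p) /\ ~ T Y.
  have [|Y [[p ps] TNY] minY] := @ex_min_measure _ (@kdim K A) P.
    by exists X; split=> //; exists idfun => y; exists y.
  exists Y; split=> [U TU|XY]; last first.
    apply: TNY; apply: tors0 => y; have [x <-] := ps y; exact: XY.
  apply: NNPP => /perpNE[f [u fu]].
  have [I [r [i [rs ii ri]]]] := image_ex f.
  have [Q [q [qs qP]]] := coker_ex i.
  apply: TNY; apply: (tors_ext (f := i) (g := q)); first by split.
    exact: tors_quo rs TU.
  apply: NNPP => TNQ; have : (kdim Q < kdim Y)%N.
    by apply: kdim_surj_lt qs _ fu; apply/qP; exists (r u).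
  rewrite ltnNge minY //; split=> //; exists (q \o p) => z.
  by have [y <-] := qs z; have [x <-] := ps y; exists x.
pose P Y := tors_le T (perp_tors Y) /\ ~ perp Y X.
have [|M [TM MNX] minM] := @ex_min_measure _ (@kdim K A) P; first by exists Y0.
have ltP Y (i : {linear Y -> M}) :
    injective i -> (kdim Y < kdim M)%N -> perp Y X.
  move=> ii YM; apply: NNPP => YNX.
  move: YM; rewrite ltnNge minM //; split=> //.
  by move=> U TU; apply: perp_sub ii _; apply: TM.
exists M; split=> //; apply: brickI => [|f [x fx]].
  by have [f [x fx]] := perpNE MNX; exists (f x).
(* If [f] is not injective, its image and kernel are both smaller than [M] and receive no nonzero
   map from [X]; so any [g] from [X] to [M] lands in the kernel of [f] and vanishes. *)
left; apply: ker0_inj => y fy; apply: NNPP => y0; apply: MNX => g z.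
have [I [p [i [ps ii pi]]]] := image_ex f.
have [S [k [ki kP]]] := sub_ex (ker_submod f).
have IX : perp I X.
  apply: (ltP _ i ii); apply: kdim_surj_lt ps _ y0.
  by apply: ii; rewrite pi fy linear0.
have SX : perp S X.
  apply: (ltP _ k ki); apply: (kdim_inj_lt (y := x) ki) => s.
  by move/(ex_intro _ s)/kP.
have [t|h hP] := factor_inj ki (f := g); last by rewrite -hP SX linear0.
by apply/kP; rewrite -pi [p _](IX (p \o g)) linear0.
Qed.

(** By [tors_le_bricks], [j] is the join of the [tgen M] over the bricks [M] in [j]. *)
Lemma CJI_brick j : CJI (@tors_le K A) j -> exists2 M, brick M & j = tgen M.
Proof.
move=> jJ; pose S T := exists2 M, brick M /\ j M & T = tgen M.
have [|M [Mb _] jM] := jJ S.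
  split=> [_ [M [_ jM] ->]|U ubU]; first exact: tgen_min.
  apply: tors_le_bricks => M Mb jM.
  by apply: ubU (tgen_self M); exists M.
by exists M.
Qed.

Lemma CMI_brick m :
  CMI (@tors_le K A) m -> exists2 M, brick M & m = perp_tors M.
Proof.
move=> mM; have [|M [Mb _] ->] := mM (fun T =>
    exists2 M, brick M /\ tors_le m (perp_tors M) & T = perp_tors M).
  split=> [_ [M [_ leM] ->] //|U lbU X UX]; apply: NNPP => mNX.
  have [M [Mb leM MNX]] := tors_perp_bricks mNX.
  by apply: MNX; apply: (lbU (perp_tors M) _ X UX); exists M.
by exists M.
Qed.

(** * Injectivity of kappa *)

Lemma perp_eq_tgen_le M N : brick M -> brick N ->
  perp_tors M = perp_tors N -> tors_le (tgen N) (tgen M).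
Proof.
move=> Mb Nb MN; have pMN X : perp M X <-> perp N X.
  by rewrite -[perp M X]/(perp_tors M X) MN.
apply: tgen_min.
have /perpNE[f [x fx]] : ~ perp N M by move/pMN/(brick_perpN Mb).
have /perpNE[g [y gy]] : ~ perp M N by move/pMN/(brick_perpN Nb).
have [Q [p [ps pP]]] := coker_ex g.
have /pMN QN : perp M Q.
  by apply: brick_coker Mb ps _ gy; apply/pP; exists y.
(* Otherwise [f] factors through the cokernel [Q] of [g], which lies in [perp N], and [f] is
   zero. *)
have [z fgz] : exists z, f (g z) <> 0.
  apply: NNPP => fg0; apply: fx.
  have [t|h <-] := factor_surj ps (f := f); last exact: QN.
  by move=> /pP[z <-]; apply: NNPP => fgz; apply: fg0; exists z.
have [h _ hK] := brick_bij (f := f \o g) Nb fgz.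
apply: (tors_quo (f := f)) (tgen_self M) => w.
by exists (g (h w)); apply: hK.
Qed.

Lemma perp_tors_inj M N : brick M -> brick N ->
  perp_tors M = perp_tors N -> tgen M = tgen N.
Proof.
by move=> Mb Nb MN; apply: tors_le_anti; apply: perp_eq_tgen_le.
Qed.

(** Both sides are the unique kappa of the same element; hence kappa does not depend on the brick
    representing it. *)
Lemma tgen_inj M N : brick M -> brick N ->
  tgen M = tgen N -> perp_tors M = perp_tors N.
Proof. by move=> Mb Nb MN; apply/kappaP => //; rewrite -MN; apply/kappaP. Qed.

End Bricks.

(** * Assembling the bijection *)

Lemma sval_inj_prop (T : Type) (P : T -> Prop) (u v : {x | P x}) :
  sval u = sval v -> u = v.
Proof.
case: u v => x Px [y Py] /= E; subst y.
by congr exist; apply: proof_irrelevance.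
Qed.

Theorem theoremA (K : fieldType) (A : falgType K) :
  exists kappa : {j : tors A | CJI (@tors_le K A) j} ->
                 {m : tors A | CMI (@tors_le K A) m},
    [/\ forall j, is_kappa (@tors_le K A) (sval j) (sval (kappa j)),
        bijective kappa
      & forall M : fgmod A, brick M ->
          exists2 j : {j : tors A | CJI (@tors_le K A) j},
            forall X, sval j X <-> Filt (Gen M) X
          & forall X, sval (kappa j) X <-> perp M X].
Proof.
(* Choice picks a partner of each [j] through some common brick; [kE] then shows that any brick
   representing [j] gives the same value. *)
pose r (j : {j : tors A | CJI (@tors_le K A) j})
       (m : {m : tors A | CMI (@tors_le K A) m}) :=
  exists M, [/\ brick M, sval j = tgen M & sval m = perp_tors M].
have [j|kappa kP] := choice r.
  have [M Mb jM] := CJI_brick (svalP j).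
  by exists (exist _ _ (perp_CMI Mb)), M.
have kE M j : brick M -> sval j = tgen M -> sval (kappa j) = perp_tors M.
  move=> Mb jM; have [N [Nb jN ->]] := kP j.
  by apply: tgen_inj => //; rewrite -jN.
exists kappa; split=> [j||M Mb].
- by have [M [Mb -> ->]] := kP j; apply/kappaP.
- apply: inj_surj_bijective => [j j' E|m].
    apply: sval_inj_prop.
    have [M [Mb -> kM]] := kP j; have [N [Nb -> kN]] := kP j'.
    by apply: perp_tors_inj => //; rewrite -kM -kN E.
  have [M Mb mM] := CMI_brick (svalP m).
  exists (exist _ _ (tgen_CJI Mb)); apply: sval_inj_prop; rewrite mM.
  exact: kE.
- exists (exist _ _ (tgen_CJI Mb)) => X; first exact: tgenE.
  by rewrite (kE M).
Qed.
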